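(* Let $\Sigma$ be a finite alphabet, $h:\Sigma^*\to M$ a monoid morphism into a finite monoid, and $L\subseteq\Sigma^*$. Assume that $L$ is $h$-substitutable, that $(L,h)$ is unit-separated, and that $(L,h)$ satisfies PTLD. Then $(L,h)$ has valid-tail exactness (VTE), and hence VTE$_1$. If moreover the set $\mathcal P$ of relative primes has finite size $q$, then $(L,h)$ has valid-tail determinism (VTD) and the set $\mathcal V$ of valid productions satisfies $|\mathcal V|\le q^2$.
   Context: $D_L(x)=\{(u,v):uxv\in L\}$; $x\equiv_L y$ iff $D_L(x)=D_L(y)$. $L$ is $h$-substitutable if for all $x,y\in\Sigma^*$, $h(x)=h(y)$ and $D_L(x)\cap D_L(y)\ne\varnothing$ imply $x\equiv_L y$. The relative syntactic congruence $\theta$ is: $x\,\theta\,y$ iff $x\equiv_L y$ and $h(x)=h(y)$; its classes $[x]$ are called relative classes; $h(P)$ denotes the common $h$-value of a class $P$. A relative class is live if $D_L(x)\neq\varnothing$ for its members. The unit class is $[\varepsilon]$. $(L,h)$ is unit-separated if $[\varepsilon]=\{\varepsilon\}$. For relative classes: $X\cdot Y=\{xy:x\in X,y\in Y\}$ and $X*Y=[xy]$ for any $x\in X,y\in Y$. A relative prime is a live relative class $P\ne[\varepsilon]$ such that whenever $P=X\cdot Y$ (equality of sets) for relative classes $X,Y$, one of $X,Y$ is $[\varepsilon]$; $\mathcal P$ is the set of relative primes. For a nonempty prime sequence $\alpha=P_1\cdots P_k$ put $\overline\alpha=P_1\cdot\ldots\cdot P_k\subseteq\Sigma^*$ and $[\overline\alpha]=P_1*\cdots*P_k$.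 For $P\in\mathcal P$ and $\alpha\in\mathcal P^*$ with $|\alpha|\ge2$, the production $P\to\alpha$ is correct if $[\overline\alpha]=P$; $\alpha$ is pleonastic if some proper contiguous block $\beta$ of $\alpha$ with $|\beta|\ge2$ has $[\overline\beta]\in\mathcal P$; a correct production is valid if its right-hand side is not pleonastic. $\mathcal V$ is the set of valid productions. PTLD: with $\mathsf T=h(\{x\in\Sigma^*:D_L(x)\ne\varnothing\})$, for every $q,r,r'\in\mathsf T$ and every relative prime $P$, $qr=h(P)=qr'$ implies $r=r'$. VTE: for every valid production $N\to\gamma\alpha$ with $\gamma,\alpha$ nonempty prime sequences, $\overline\alpha=[\overline\alpha]$ as sets. VTE$_1$: the same only when $\gamma$ is a single prime, i.e. for every valid $P\to A\alpha$ with $A\in\mathcal P$, $\alpha$ nonempty, $\overline\alpha=[\overline\alpha]$. VTD: whenever $N\to A\alpha$ and $N\to A\beta$ are valid productions with the same left-hand prime $N$ and the same first right-hand prime $A$, then $\alpha=\beta$. *)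

(* Defs.v *)
From HB Require Import structures.
From mathcomp Require Import all_boot.
From mathcomp Require Import boolp classical_sets cardinality.

Set Implicit Arguments.
Unset Strict Implicit.
Unset Printing Implicit Defensive.

Local Open Scope classical_set_scope.

(* The free monoid on T: words under concatenation. *)
HB.instance Definition _ (T : choiceType) :=
  isMonoid.Build (seq T) (@catA T) (@cat0s T) (@cats0 T).

Section RelativeClasses.
Context {Sigma : finType} {M : monoidType}.
Implicit Types (L : set (seq Sigma)) (h : seq Sigma -> M).
Implicit Types (x y u v : seq Sigma) (X Y N A P : set (seq Sigma)).
Implicit Types (alpha beta gamma : seq (set (seq Sigma))).

Definition contexts L x : set (seq Sigma * seq Sigma) :=
  [set uv | L (uv.1 ++ x ++ uv.2)].

Definition syn_eq L x y : Prop := contexts L x = contexts L y.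

Definition substitutable L h : Prop :=
  forall x y, h x = h y -> contexts L x `&` contexts L y !=set0 -> syn_eq L x y.

Definition theta L h x y : Prop := syn_eq L x y /\ h x = h y.

Definition rclass L h x : set (seq Sigma) := [set y | theta L h x y].

Definition is_rclass L h X : Prop := exists x, X = rclass L h x.

(* An arbitrary element of X (the empty word if X is empty, which never
   happens for a relative class). *)
Definition repr X : seq Sigma := xget [::] X.

Definition hclass h X : M := h (repr X).

Definition live L X : Prop := forall x, X x -> contexts L x !=set0.

Definition unit_class L h : set (seq Sigma) := rclass L h [::].

Definition unit_separated L h : Prop := unit_class L h = [set [::]].

Definition cprod X Y : set (seq Sigma) := [set x ++ y | x in X & y in Y].

(* X * Y; independent of the representatives by [cstar_rclass]. *)
Definition cstar L h X Y : set (seq Sigma) := rclass L h (repr X ++ repr Y).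

Definition rprime L h P : Prop :=
  [/\ is_rclass L h P, live L P, P <> unit_class L h &
    forall X Y, is_rclass L h X -> is_rclass L h Y -> P = cprod X Y ->
      X = unit_class L h \/ Y = unit_class L h].

Definition rprimes L h : set (set (seq Sigma)) := [set P | rprime L h P].

Definition seqprod alpha : set (seq Sigma) := foldr cprod [set [::]] alpha.

Definition seqstar L h alpha : set (seq Sigma) :=
  foldr (cstar L h) (unit_class L h) alpha.

Definition production L h N alpha : Prop :=
  [/\ rprime L h N, forall P, P \in alpha -> rprime L h P & 2 <= size alpha].

Definition correct L h N alpha : Prop :=
  production L h N alpha /\ seqstar L h alpha = N.

Definition pleonastic L h alpha : Prop :=
  exists s1 beta s2, [/\ alpha = s1 ++ beta ++ s2, size beta < size alpha,
    2 <= size beta & rprime L h (seqstar L h beta)].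

Definition valid L h N alpha : Prop :=
  correct L h N alpha /\ ~ pleonastic L h alpha.

Definition valid_productions L h :
    set (set (seq Sigma) * seq (set (seq Sigma))) :=
  [set p | valid L h p.1 p.2].

Definition live_values L h : set M := h @` [set x | contexts L x !=set0].

Definition PTLD L h : Prop :=
  forall (q r r' : M) P,
    live_values L h q -> live_values L h r -> live_values L h r' ->
    rprime L h P ->
    (q * r)%g = hclass h P -> hclass h P = (q * r')%g -> r = r'.

Definition VTE L h : Prop :=
  forall N gamma alpha, gamma <> [::] -> alpha <> [::] ->
    valid L h N (gamma ++ alpha) -> seqprod alpha = seqstar L h alpha.

Definition VTE1 L h : Prop :=
  forall N A alpha, alpha <> [::] ->
    valid L h N (A :: alpha) -> seqprod alpha = seqstar L h alpha.

Definition VTD L h : Prop :=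
  forall N A alpha beta,
    valid L h N (A :: alpha) -> valid L h N (A :: beta) -> alpha = beta.

Lemma repr_rclass L h x : theta L h x (repr (rclass L h x)).
Proof. by apply: (@xgetI _ [::] (rclass L h x) x). Qed.

Lemma hclass_rclass L h x : hclass h (rclass L h x) = h x.
Proof. by rewrite /hclass -(repr_rclass L h x).2. Qed.

Lemma eq_rclass L h x y : theta L h x y -> rclass L h x = rclass L h y.
Proof. by case=> Dxy hxy; rewrite /rclass /theta /syn_eq Dxy hxy. Qed.

Lemma theta_cat L h x x' y y' : monoid_morphism h ->
  theta L h x x' -> theta L h y y' -> theta L h (x ++ y) (x' ++ y').
Proof.
move=> [_ hM] [Dx hx] [Dy hy]; split; last first.
  by rewrite -[x ++ y]/(x * y)%g -[x' ++ y']/(x' * y')%g !hM hx hy.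
apply/seteqP; split=> -[u v]; rewrite /contexts /= => Luv.
- have: contexts L x (u, y ++ v) by rewrite /contexts /= -catA in Luv *.
  rewrite Dx /contexts /= => Luv'.
  have: contexts L y (u ++ x', v) by rewrite /contexts /= -catA.
  by rewrite Dy /contexts /= -!catA.
- have: contexts L x' (u, y' ++ v) by rewrite /contexts /= -catA in Luv *.
  rewrite -Dx /contexts /= => Luv'.
  have: contexts L y' (u ++ x, v) by rewrite /contexts /= -catA.
  by rewrite -Dy /contexts /= -!catA.
Qed.

Lemma cstar_rclass L h x y : monoid_morphism h ->
  cstar L h (rclass L h x) (rclass L h y) = rclass L h (x ++ y).
Proof.
move=> hM; apply/esym/eq_rclass.
by apply: theta_cat => //; apply: repr_rclass.
Qed.

End RelativeClasses.

(* Main.v *)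
(* Under PTLD and unit separation the relative primes are prefix codes, and in
   a prime N the class of a tail is determined by the class of the
   complementary head.  Consequently, if the tail alpha of a valid production
   is compared with any factorization D :: delta of the class of alpha into
   primes, the first factor D cannot begin strictly inside the first prime P of
   alpha, and it cannot end beyond P either, since it would then be the class
   of a block of alpha, contradicting non-pleonasticity.  So D = P, and by
   induction the class of alpha has alpha as its only factorization into
   primes.  Since every live class has one, tails are exact; and since the tail
   class is determined by (N, A), so is the tail. *)
Require Import Defs.
From mathcomp Require Import all_boot.
From mathcomp Require Import boolp classical_sets cardinality.
Local Open Scope classical_set_scope.
Local Open Scope card_scope.

Set Implicit Arguments.
Unset Strict Implicit.
Unset Printing Implicit Defensive.

(** Levi's lemma (equidivisibility of the free monoid). *)
Lemma cat_eq_prefix (T : Type) (a b c d : seq T) : a ++ b = c ++ d ->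
  (exists s, a = c ++ s /\ d = s ++ b) \/ (exists s, c = a ++ s /\ b = s ++ d).
Proof.
elim: a c => [|x a IH] [|y c] /=.
- by move=> ->; left; exists [::].
- by move=> ->; right; exists (y :: c).
- by move=> <-; left; exists (x :: a).
- case=> <- /IH [] [s [-> ->]]; [left|right]; by exists s.
Qed.

Section RelativePrimes.
Context (Sigma : finType) (M : monoidType) (h : seq Sigma -> M).
Context (h_morph : monoid_morphism h) (L : set (seq Sigma)).

Local Notation theta := (theta L h).
Local Notation rclass := (rclass L h).
Local Notation prime := (rprime L h).
Local Notation star := (seqstar L h).
Implicit Types (x y z u v w : seq Sigma) (P N A : set (seq Sigma)).
Implicit Types (alpha beta gamma delta : seq (set (seq Sigma))).

(** * Relative classes and sequences of primes *)

Lemma morph_cat x y : h (x ++ y) = (h x * h y)%g.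
Proof. exact: h_morph.2. Qed.

Lemma theta_refl x : theta x x. Proof. by []. Qed.

Lemma theta_sym x y : theta x y -> theta y x.
Proof. by case=> Dxy hxy; split; [exact: esym|]. Qed.

Lemma theta_trans x y z : theta x y -> theta y z -> theta x z.
Proof. by move=> [Dxy hxy] [Dyz hyz]; split; [exact: etrans Dyz|rewrite hxy]. Qed.

Lemma rclass_theta x y : rclass x = rclass y -> theta x y.
Proof. by move=> E; have : rclass y y by []; rewrite -E. Qed.

Lemma is_rclassE P x : is_rclass L h P -> P x -> P = rclass x.
Proof. by case=> y -> /eq_rclass. Qed.

Lemma rprime_rclass P x : prime P -> P x -> P = rclass x.
Proof. by case=> rP *; exact: is_rclassE. Qed.

Lemma rprime_inhabited P : prime P -> exists x, P x.
Proof. by case=> -[x ->] *; exists x. Qed.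

Lemma seqprod_cat alpha beta x y :
  seqprod alpha x -> seqprod beta y -> seqprod (alpha ++ beta) (x ++ y).
Proof.
elim: alpha x => [|P alpha IH] x /=; first by move=> ->.
case=> p Pp [a /IH IHa <-] /IHa Hay.
by rewrite -catA; exists p => //; exists (a ++ y).
Qed.

Lemma seqprod_catP alpha beta : seqprod (alpha ++ beta)
  = cprod (seqprod alpha) (seqprod beta).
Proof.
apply/seteqP; split => [w|_ [x ax [y By <-]]]; last exact: seqprod_cat.
elim: alpha w => [|P alpha IH] w /=.
  by move=> Bw; exists [::] => //; exists w.
case=> p Pp [_ /IH [a aa [b Bb <-]] <-].
exists (p ++ a); first by exists p => //; exists a.
by exists b => //; rewrite catA.
Qed.

(** Since [theta] is a congruence, any word of the product can serve to compute [star]; later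
    arguments about [star] thus become arguments about single words. *)
Lemma star_rclass alpha w : (forall P, P \in alpha -> prime P) ->
  seqprod alpha w -> star alpha = rclass w.
Proof.
elim: alpha w => [|P alpha IH] w Hp /=; first by move=> ->.
case=> p Pp [a aa <-].
rewrite (IH a) // => [|Q Qa]; last by apply: Hp; rewrite inE Qa orbT.
rewrite (rprime_rclass _ Pp) ?cstar_rclass //.
by apply: Hp; rewrite inE eqxx.
Qed.

Lemma seqprod_inhabited alpha : (forall P, P \in alpha -> prime P) ->
  exists w, seqprod alpha w.
Proof.
elim: alpha => [|P alpha IH] Hp; first by exists [::].
have [|w aw] := IH; first by move=> Q Qa; apply: Hp; rewrite inE Qa orbT.
have [|p Pp] := @rprime_inhabited P; first by apply: Hp; rewrite inE eqxx.
by exists (p ++ w), p => //; exists w.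
Qed.

Lemma contexts_infix x y z uv : contexts L (x ++ y ++ z) uv ->
  contexts L y (uv.1 ++ x, z ++ uv.2).
Proof. by rewrite /contexts /= -!catA. Qed.

(** * Unit separation and factorization into primes *)

Section UnitSeparated.
Context (L_unit : unit_separated L h).

Lemma theta_nil x : theta [::] x -> x = [::].
Proof. by move=> t; have: unit_class L h x by []; rewrite L_unit. Qed.

Lemma rclass_unit x : rclass x = unit_class L h -> x = [::].
Proof. by move/rclass_theta/theta_sym/theta_nil. Qed.

Lemma rprime_nonnil P x : prime P -> P x -> x <> [::].
Proof.
move=> pP Px x0; case: (pP) => _ _ + _; apply.
by rewrite (rprime_rclass pP Px) x0.
Qed.

(** Induction on the length of [x]: a non-unit live class that is not prime splits into two non-unit
    classes. Both parts of [x] are then nonempty, hence shorter, and they stay live as infixes of a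
    live word. *)
Lemma prime_factorization x : contexts L x !=set0 ->
  exists2 delta, (forall P, P \in delta -> prime P) & seqprod delta = rclass x.
Proof.
have [n] := ubnP (size x); elim: n x => // n IH x; rewrite ltnS => le_xn lx.
have [x0|x_n0] := eqVneq x [::]; first by exists [::] => //; rewrite x0; exact/esym.
have [px|npx] := pselect (prime (rclass x)).
  exists [:: rclass x] => [P|/=]; first by rewrite inE => /eqP ->.
  apply/seteqP; split=> [_ [y xy [_ -> <-]]|y xy]; first by rewrite cats0.
  by exists y => //; exists [::]; rewrite ?cats0.
have [X [Y [rX rY eXY X1 Y1]]] : exists X Y, [/\ is_rclass L h X,
    is_rclass L h Y, rclass x = cprod X Y, X <> unit_class L h &
    Y <> unit_class L h].
  apply: contrapT => noXY; apply: npx; split.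
  - by exists x.
  - by move=> y [Dxy _]; rewrite -Dxy.
  - by move/rclass_unit => x0; rewrite x0 in x_n0.
  - move=> X Y rX rY eXY; apply: contrapT => /not_orP[X1 Y1].
    by apply: noXY; exists X, Y.
have : cprod X Y x by rewrite -eXY.
case=> a Xa [b Yb xE].
have EX := is_rclassE rX Xa; have EY := is_rclassE rY Yb.
have sa : 0 < size a.
  by rewrite lt0n size_eq0; apply/eqP => a0; apply: X1; rewrite EX a0.
have sb : 0 < size b.
  by rewrite lt0n size_eq0; apply/eqP => b0; apply: Y1; rewrite EY b0.
rewrite -xE size_cat in le_xn.
case: lx => uv; rewrite -xE => Lab.
have [||da pa ea] := IH a.
- by apply: leq_trans le_xn; rewrite -addn1 leq_add2l.
- by eexists; exact: (@contexts_infix [::] a b uv Lab).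
have [||db pb eb] := IH b.
- by apply: leq_trans le_xn; rewrite -add1n leq_add2r.
- by eexists; apply: (@contexts_infix a b [::]); rewrite cats0; exact: Lab.
exists (da ++ db); first by move=> P; rewrite mem_cat => /orP[/pa|/pb].
by rewrite seqprod_catP ea eb -EX -EY xE eXY.
Qed.

(** * Quotients of primes and uniqueness of tails *)

Section TailDeterminism.
Context (L_subst : substitutable L h) (L_ptld : PTLD L h).

(** By congruence [c'] may be replaced by [c]. Then PTLD yields [h w = h w'], and a context of the
    live class [P], extended by [c] on the left, is shared by [w] and [w'], so substitutability
    applies. *)
Lemma rprime_left_quotient P c c' w w' : prime P -> theta c c' ->
  P (c ++ w) -> P (c' ++ w') -> theta w w'.
Proof.
move=> pP cc Pw Pw'.
have Pcw' : P (c ++ w').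
  move: Pw'; rewrite {1}(rprime_rclass pP Pw) => Pw'.
  rewrite (rprime_rclass pP Pw).
  by apply: (theta_trans Pw'); apply: theta_cat => //; apply: theta_sym.
have [_ /(_ _ Pw) [uv Lcw] _ _] := pP.
have hP x : P x -> hclass h P = h x.
  by move=> Px; rewrite (rprime_rclass pP Px) hclass_rclass.
have Lcw' : contexts L (c ++ w') uv.
  by move: Pcw'; rewrite {1}(rprime_rclass pP Pw) => -[<-].
have cx y : contexts L (c ++ y) uv -> contexts L y (uv.1 ++ c, uv.2).
  by move=> Ly; apply: (@contexts_infix c y [::]); rewrite cats0.
have hw : h w = h w'.
  apply: (L_ptld (q := h c) (P := P)) => //.
  - exists c => //; eexists; exact: (@contexts_infix [::] c w uv Lcw).
  - by exists w => //; eexists; apply: cx Lcw.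
  - by exists w' => //; eexists; apply: cx Lcw'.
  - by rewrite -morph_cat -hP.
  - by rewrite -morph_cat -hP.
split=> //; apply: L_subst => //.
by exists (uv.1 ++ c, uv.2); split; apply: cx.
Qed.

Lemma rprime_prefix_free P x s : prime P -> P x -> P (x ++ s) -> s = [::].
Proof.
move=> pP Px Pxs; apply: theta_nil.
by apply: (rprime_left_quotient pP (theta_refl x)) => //; rewrite cats0.
Qed.

(** If [s] were nonempty, every word of [P] would split as a word of [D] followed by one of the
    class of [s], so [P] would be the product of these two non-unit classes. *)
Lemma first_factor_not_shorter P D Y b x s : prime P -> prime D ->
  (forall p, P p -> cprod D Y (p ++ b)) -> D x -> P (x ++ s) -> s = [::].
Proof.
move=> pP pD HW Dx Pxs; apply: contrapT => s_n0.
have xsP : forall p, P p -> theta (x ++ s) p.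
  by move=> p; rewrite (rprime_rclass pP Pxs).
have nsub : ~ P `<=` cprod D (rclass s).
  move=> sub; case: (pP) => _ _ _ /(_ D (rclass s)) [].
  - by case: pD.
  - by exists s.
  - apply/seteqP; split=> // _ [x' Dx' [s' ss' <-]].
    rewrite (rprime_rclass pP Pxs); apply: theta_cat => //.
    by move: Dx'; rewrite {1}(rprime_rclass pD Dx).
  - by case: pD.
  - by move/rclass_unit.
apply: nsub => p Pp.
have [x' Dx' [y _ /cat_eq_prefix [] [t [E1 E2]]]] := HW _ Pp.
  (* [D] contains both [x] and [x ++ s ++ t], so it is not prefix-free *)
  suff: s ++ t = [::] by case: (s) s_n0.
  apply: (rprime_prefix_free pD Dx).
  move: Dx'; rewrite E1 {1}(rprime_rclass pD Dx) => xpt.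
  rewrite (rprime_rclass pD Dx); apply: theta_trans xpt _.
  by rewrite catA; apply: theta_cat => //; apply: theta_sym; exact: xsP.
exists x' => //; exists t => //.
(* Both [x ++ s] and [x' ++ t] lie in [P], with [x] and [x'] in the same class [D]. *)
apply: (rprime_left_quotient (c := x) (c' := x') pP) => //; last by rewrite -E1.
by move: Dx'; rewrite {1}(rprime_rclass pD Dx).
Qed.

(** The head [gamma] varies in the induction on the tail: it absorbs the first prime of the tail,
    while [N] and the whole right-hand side stay fixed. *)
Lemma valid_tail_unique N gamma alpha delta : prime N -> gamma <> [::] ->
  (forall P, P \in gamma ++ alpha -> prime P) -> star (gamma ++ alpha) = N ->
  ~ pleonastic L h (gamma ++ alpha) -> (forall P, P \in delta -> prime P) ->
  seqprod delta = star alpha -> delta = alpha.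
Proof.
move=> pN; elim: alpha gamma delta => [|P beta IH] gamma delta g0 pga ega npl pd ed.
  (* For an empty tail, a nonempty [delta] would put the empty word into a product that starts with
     a prime. *)
  case: delta pd ed => // D delta pd ed.
  have : seqprod (D :: delta) [::] by rewrite ed /=; apply: theta_refl.
  case=> x Dx [y _ xy0]; case: (@rprime_nonnil D x) => //.
    by apply: pd; rewrite inE eqxx.
  by case: x {Dx} xy0.
have pP : prime P by apply: pga; rewrite mem_cat inE eqxx orbT.
have pb Q : Q \in beta -> prime Q.
  by move=> Qb; apply: pga; rewrite mem_cat inE Qb !orbT.
have pg Q : Q \in gamma -> prime Q.
  by move=> Qg; apply: pga; rewrite mem_cat Qg.
have pPb Q : Q \in P :: beta -> prime Q.
  by rewrite inE => /orP[/eqP ->|/pb].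
have [b0 bb0] := seqprod_inhabited pb.
have [p0 Pp0] := rprime_inhabited pP.
have [c gc] := seqprod_inhabited pg.
have Eb := star_rclass pb bb0.
have EW : star (P :: beta) = rclass (p0 ++ b0).
  by apply: star_rclass => //; exists p0 => //; exists b0.
have EN : N = rclass (c ++ p0 ++ b0).
  rewrite -ega; apply: star_rclass => //; apply: seqprod_cat => //.
  by exists p0 => //; exists b0.
have Wpb p b : P p -> star beta b -> star (P :: beta) (p ++ b).
  rewrite EW Eb => Pp bb; apply: theta_cat => //.
  by move: Pp; rewrite {1}(rprime_rclass pP Pp0).
case: delta pd ed => [|D delta] pd ed.
  have := Wpb _ _ Pp0; rewrite Eb -ed => /(_ _ (theta_refl b0)) /= pb0.
  by case: (rprime_nonnil pP Pp0); case: (p0) pb0.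
have pD : prime D by apply: pd; rewrite inE eqxx.
have pd' Q : Q \in delta -> prime Q by move=> Qd; apply: pd; rewrite inE Qd orbT.
have IHb d : (forall Q, Q \in d -> prime Q) -> seqprod d = star beta -> d = beta.
  by apply: (IH (rcons gamma P)); rewrite ?cat_rcons //; case: (gamma).
have DY p b : P p -> star beta b -> cprod D (seqprod delta) (p ++ b).
  by move=> Pp bb; move: (Wpb _ _ Pp bb); rewrite -ed.
have short x s : D x -> P (x ++ s) -> s = [::].
  apply: (@first_factor_not_shorter _ _ (seqprod delta) b0) => // p Pp.
  by apply: DY => //; rewrite Eb; apply: theta_refl.
(* Cancellation inside [N]: it contains both [c ++ p0 ++ b0] and [c ++ p ++ w]. *)
have starN w p : P p -> star (P :: beta) (p ++ w) -> star beta w.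
  rewrite EW Eb => Pp tw.
  apply: (@rprime_left_quotient _ (c ++ p0) (c ++ p) _ _ pN).
  - apply: theta_cat => //.
    by move: Pp; rewrite {1}(rprime_rclass pP Pp0).
  - by rewrite EN -catA; apply: theta_refl.
  - by rewrite EN -catA; apply: theta_cat.
(* When [D = P], cancelling the first prime on both sides reduces to [beta]; prefix-freeness of [P]
   makes the cut fall exactly after [p0]. *)
have [eDP|nDP] := pselect (D = P).
  rewrite eDP; congr (_ :: _); apply: IHb => //.
  apply/seteqP; split=> [z dz|b bb].
    apply: (starN _ p0) => //; rewrite -ed; exists p0; rewrite ?eDP //.
    by exists z.
  have [x Dx [y dy]] := DY _ _ Pp0 bb.
  rewrite eDP in Dx; case/cat_eq_prefix => -[s [E1 E2]].
    by move: Dx; rewrite E1 => /(rprime_prefix_free pP Pp0) s0;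
       rewrite E2 s0.
  by move: Pp0; rewrite E1 => /(rprime_prefix_free pP Dx) s0; move: dy; rewrite E2 s0.
(* Distinct classes are disjoint, so the [D]-part of [p0 ++ b] is not [p0]; by [short] it is not a
   proper prefix of [p0] either, hence it runs beyond it. *)
have long b : star beta b ->
    exists s y, [/\ D (p0 ++ s), s <> [::], seqprod delta y & b = s ++ y].
  move=> bb; have [x Dx [y dy]] := DY _ _ Pp0 bb.
  have ne : x <> p0.
    by move=> xp; apply: nDP; rewrite (rprime_rclass pD Dx) xp -(rprime_rclass pP Pp0).
  case/cat_eq_prefix => -[s [E1 E2]].
    exists s, y; split=> //; first by rewrite -E1.
    by move=> s0; apply: ne; rewrite E1 s0 cats0.
  move: (Pp0); rewrite E1 => /(short _ _ Dx) s0.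
  by case: ne; rewrite E1 s0 cats0.
have [|s [y [Ds s0 dy eb0]]] := long b0; first by rewrite Eb; apply: theta_refl.
have [|sigma psig esig] := @prime_factorization s.
  have [_ /(_ _ Ds) [uv Luv] _ _] := pD.
  by eexists; apply: (@contexts_infix p0 s [::]); rewrite cats0; exact: Luv.
(* The overhang [s] factors into [sigma], so [sigma ++ delta] factors the class of [beta]. Every
   other overhang is [theta]-equivalent to [s], by left quotient in [D]. *)
have ebeta : sigma ++ delta = beta.
  apply: IHb => [Q|]; first by rewrite mem_cat => /orP[/psig|/pd'].
  rewrite seqprod_catP esig.
  apply/seteqP; split=> [_ [s' ss' [y' dy' <-]]|b /long [s' [y' [Ds' _ dy' ->]]]].
    have ty : theta y y'.
      by apply/rclass_theta; rewrite -(star_rclass pd' dy) -(star_rclass pd' dy').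
    by rewrite Eb eb0; apply: theta_cat.
  exists s'; last by exists y'.
  exact: (rprime_left_quotient pD (theta_refl p0)).
(* The block [P :: sigma] has the prime class [D]. It is proper because [gamma] is nonempty, and has
   length at least two because [s] is nonempty. *)
case: npl; exists gamma, (P :: sigma), delta; split.
- by rewrite /= ebeta.
- rewrite -ebeta !size_cat /= size_cat -[X in X < _]add0n -addSn leq_add //.
    by rewrite lt0n size_eq0; apply/eqP.
  by rewrite ltnS leq_addr.
- case: (sigma) esig => // esig.
  have : rclass s s by [].
  by rewrite -esig.
- have -> : star (P :: sigma) = rclass (p0 ++ s).
    apply: star_rclass => [Q|]; first by rewrite inE => /orP[/eqP ->|/psig].
    by exists p0 => //; exists s => //; rewrite esig.
  by rewrite -(rprime_rclass pD Ds).
Qed.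

Lemma valid_tail_exact : VTE L h.
Proof.
move=> N gamma alpha g0 a0 [[[pN pga _] ega] npl].
have pa Q : Q \in alpha -> prime Q by move=> Qa; apply: pga; rewrite mem_cat Qa orbT.
have [w gaw] := seqprod_inhabited pga.
move: (gaw); rewrite seqprod_catP => -[c gc [a aa cw]].
have Ea := star_rclass pa aa.
have [|delta pd ed] := @prime_factorization a.
  have [_ lN _ _] := pN; case: (lN w).
    by rewrite -ega (star_rclass pga gaw); apply: theta_refl.
  move=> uv; rewrite -cw => Luv; eexists.
  by apply: (@contexts_infix c a [::]); rewrite cats0; exact: Luv.
rewrite Ea -ed (valid_tail_unique pN g0 pga ega npl pd) ?Ea //.
Qed.

Lemma valid_tail_deterministic : VTD L h.
Proof.
move=> N A alpha beta va vb.
have tail a : valid L h N (A :: a) -> exists x y,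
    [/\ A x, N (x ++ y), star a = rclass y & seqprod a = star a].
  move=> v; have [[[pN pAa sz] ea] _] := v.
  have pa Q : Q \in a -> prime Q by move=> Qa; apply: pAa; rewrite inE Qa orbT.
  have [_ [x Ax [y ay _]]] := seqprod_inhabited pAa.
  exists x, y; split=> //.
  - rewrite -ea (@star_rclass _ (x ++ y)) //.
    by exists x => //; exists y.
  - exact: star_rclass.
  - apply: (@valid_tail_exact N [:: A]) => //.
    by move=> a0; rewrite a0 in sz.
have [x [y [Ax Nxy Ea Xa]]] := tail _ va.
have [x' [y' [Ax' Nxy' Eb Xb]]] := tail _ vb.
have [[[pN pAa _] ea] _] := va.
have [[[_ pAb _] eb] npl] := vb.
have pA : prime A by apply: pAa; rewrite inE eqxx.
(* By exactness [alpha] is a prime factorization of its own class, which is also the class of [beta]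
   by left quotient in [N]. *)
apply: (@valid_tail_unique N [:: A]) => //.
  by move=> Q Qa; apply: pAa; rewrite inE Qa orbT.
rewrite Xa Ea Eb; apply: eq_rclass.
apply: (rprime_left_quotient pN _ Nxy Nxy').
by apply: rclass_theta; rewrite -!(rprime_rclass pA).
Qed.

End TailDeterminism.
End UnitSeparated.
End RelativePrimes.

Theorem theorem7p22 (Sigma : finType) (M : monoidType)
    (M_finite : finite_set [set: M])
    (h : seq Sigma -> M) (h_morph : monoid_morphism h)
    (L : set (seq Sigma))
    (L_subst : substitutable L h)
    (L_unit : unit_separated L h)
    (L_ptld : PTLD L h) :
  [/\ VTE L h,
      VTE1 L h &
      forall q : nat, rprimes L h #= `I_q ->
        VTD L h /\ valid_productions L h #<= `I_(q ^ 2)].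
Proof.
have vte : VTE L h by exact: valid_tail_exact.
split=> //; first by move=> N A alpha a0 v; exact: (vte N [:: A]).
have vtd : VTD L h by exact: valid_tail_deterministic.
move=> q /card_set_bijP [f [f_fun f_inj _]]; split=> //.
have fP P : rprime L h P -> f P < q by exact: f_fun.
(* The pair of left-hand side and first right-hand prime, read as a two-digit number in base [q]; by
   VTD this pair determines the production. The default [set0] is never reached on valid
   productions. *)
pose g (p : set (seq Sigma) * seq (set (seq Sigma))) :=
  f p.1 * q + f (head set0 p.2).
have g_inj : {in valid_productions L h &, injective g}.
  move=> [N [|A alpha]] [N' [|A' alpha']] /set_mem/= v /set_mem/= v';
    [by case: v => -[[]]..|by case: v' => -[[]]|].
  have [[[pN pA _] _] _] := v; have [[[pN' pA' _] _] _] := v'.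
  have {}pA : rprime L h A by apply: pA; rewrite inE eqxx.
  have {}pA' : rprime L h A' by apply: pA'; rewrite inE eqxx.
  have q_gt0 : 0 < q by apply: leq_ltn_trans (fP _ pN).
  rewrite /g /= => gE.
  have fA : f A = f A'.
    by have /(congr1 (modn^~ q)) := gE; rewrite !modnMDl !modn_small ?fP.
  have fN : f N = f N'.
    have /(congr1 (divn^~ q)) := gE.
    by rewrite !divnMDl // !divn_small ?fP // !addn0.
  have eA : A = A' by apply: f_inj => //; apply/mem_set.
  have eN : N = N' by apply: f_inj => //; apply/mem_set.
  by subst; congr (_, _ :: _); exact: vtd v v'.
rewrite -(card_le_eql (inj_card_eq g_inj)); apply: subset_card_le.
move=> _ [[N [|A alpha]] [[[pN pA _] _] _] <-] //.
rewrite /g /= expnS expn1; apply: (@leq_trans ((f N).+1 * q)).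
  by rewrite mulSnr ltn_add2l fP //; apply: pA; rewrite inE eqxx.
by rewrite leq_mul2r fP ?orbT.
Qed.
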